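(* Over $\mathsf{RCA}_0$, $\mathsf{Lex{\text -}Indec}^3_2$ implies arithmetic comprehension.
   Context: Order $\mathbb{N}^n$ lexicographically: $(x_1,\dots,x_n)<(y_1,\dots,y_n)$ iff for some $i$, $x_j=y_j$ for $j<i$ and $x_i<y_i$. A lexicographic embedding is a function $h:\mathbb{N}^n\to\mathbb{N}^n$ that is strictly increasing with respect to this order. $\mathsf{Lex{\text -}Indec}^n_k$ is the statement: for every coloring $c:\mathbb{N}^n\to\{0,\dots,k-1\}$ there is a lexicographic embedding $h:\mathbb{N}^n\to\mathbb{N}^n$ such that $c\circ h$ is constant. *)

(* Defs.v *)
From mathcomp Require Import all_boot.

Set Implicit Arguments.
Unset Strict Implicit.
Unset Printing Implicit Defensive.

(* MathComp (boot only); conventions for second-order arithmetic follow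
   Simpson, "Subsystems of Second Order Arithmetic".

   "Over RCA_0, A implies B" is rendered as logical consequence: every
   L_2-structure that is a model of RCA_0 and of A is a model of B.  Structures
   are arbitrary: the first-order part may be nonstandard and the second-order
   part is any collection of subsets of it. *)

(** * Syntax of L_2 *)

(* De Bruijn indices, with separate index spaces for number variables and set
   variables. *)
Inductive term : Type :=
| tvar of nat
| tzero
| tone
| tadd of term & term
| tmul of term & term.

Inductive form : Type :=
| feq of term & term
| flt of term & term
| fmem of term & nat
| fnot of form
| fand of form & form
| for_ of form & form
| fimp of form & form
| fiff of form & form
| fall of form
| fex of form
| fall2 of form
| fex2 of form.

Fixpoint tshift (t : term) : term :=
  match t with
  | tvar n => tvar n.+1
  | tzero => tzero
  | tone => tone
  | tadd t1 t2 => tadd (tshift t1) (tshift t2)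
  | tmul t1 t2 => tmul (tshift t1) (tshift t2)
  end.

(* [tshift] ensures that the bounding term does not contain the variable being
   bound. *)
Definition fallb (t : term) (p : form) : form :=
  fall (fimp (flt (tvar 0) (tshift t)) p).
Definition fexb (t : term) (p : form) : form :=
  fex (fand (flt (tvar 0) (tshift t)) p).

Inductive bounded : form -> Prop :=
| bounded_eq t1 t2 : bounded (feq t1 t2)
| bounded_lt t1 t2 : bounded (flt t1 t2)
| bounded_mem t X : bounded (fmem t X)
| bounded_not p : bounded p -> bounded (fnot p)
| bounded_and p q : bounded p -> bounded q -> bounded (fand p q)
| bounded_or p q : bounded p -> bounded q -> bounded (for_ p q)
| bounded_imp p q : bounded p -> bounded q -> bounded (fimp p q)
| bounded_iff p q : bounded p -> bounded q -> bounded (fiff p q)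
| bounded_all t p : bounded p -> bounded (fallb t p)
| bounded_ex t p : bounded p -> bounded (fexb t p).

Inductive Sigma01 : form -> Prop :=
| Sigma01_ex p : bounded p -> Sigma01 (fex p).

Inductive Pi01 : form -> Prop :=
| Pi01_all p : bounded p -> Pi01 (fall p).

(* No set quantifiers; free set variables are allowed. *)
Fixpoint arithmetical (p : form) : bool :=
  match p with
  | feq _ _ | flt _ _ | fmem _ _ => true
  | fnot q | fall q | fex q => arithmetical q
  | fand q r | for_ q r | fimp q r | fiff q r =>
      arithmetical q && arithmetical r
  | fall2 _ | fex2 _ => false
  end.

(** * L_2-structures and satisfaction *)

Record L2structure : Type := L2Structure {
  dom :> Type;
  zero : dom;
  one : dom;
  add : dom -> dom -> dom;
  mul : dom -> dom -> dom;
  lt : dom -> dom -> Prop;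
  is_set : (dom -> Prop) -> Prop;
  set_inhabited : exists X : dom -> Prop, is_set X
}.

Arguments zero {_}.
Arguments one {_}.

Definition scons (A : Type) (a : A) (e : nat -> A) : nat -> A :=
  fun n => if n is m.+1 then e m else a.

Fixpoint eval (M : L2structure) (e : nat -> M) (t : term) : M :=
  match t with
  | tvar n => e n
  | tzero => zero
  | tone => one
  | tadd t1 t2 => add (eval e t1) (eval e t2)
  | tmul t1 t2 => mul (eval e t1) (eval e t2)
  end.

Fixpoint sat (M : L2structure) (e : nat -> M) (E : nat -> M -> Prop)
    (p : form) : Prop :=
  match p with
  | feq t1 t2 => eval e t1 = eval e t2
  | flt t1 t2 => lt (eval e t1) (eval e t2)
  | fmem t X => E X (eval e t)
  | fnot q => ~ sat e E q
  | fand q r => sat e E q /\ sat e E r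
  | for_ q r => sat e E q \/ sat e E r
  | fimp q r => sat e E q -> sat e E r
  | fiff q r => sat e E q <-> sat e E r
  | fall q => forall m : M, sat (scons m e) E q
  | fex q => exists m : M, sat (scons m e) E q
  | fall2 q => forall X : M -> Prop, is_set X -> sat e (scons X E) q
  | fex2 q => exists X : M -> Prop, is_set X /\ sat e (scons X E) q
  end.

(** * RCA_0 and arithmetic comprehension *)

Record basic_axioms (M : L2structure) : Prop := BasicAxioms {
  succ_neq0 : forall m : M, add m one <> zero;
  succ_inj : forall m n : M, add m one = add n one -> m = n;
  add_zero : forall m : M, add m zero = m;
  add_succ : forall m n : M, add m (add n one) = add (add m n) one;
  mul_zero : forall m : M, mul m zero = zero;
  mul_succ : forall m n : M, mul m (add n one) = add (mul m n) m;
  not_lt_zero : forall m : M, ~ lt m zero;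
  lt_succ : forall m n : M, lt m (add n one) <-> lt m n \/ m = n
}.

(* In the schemata below the distinguished variable is number variable 0; the
   valuations e and E supply arbitrary number and set parameters, which amounts
   to taking universal closures.  The set asserted to exist is not among the
   variables of the formula, so no freshness condition is needed. *)
Definition Sigma01_induction (M : L2structure) : Prop :=
  forall (p : form) (e : nat -> M) (E : nat -> M -> Prop),
    Sigma01 p -> (forall i, is_set (E i)) ->
    sat (scons zero e) E p ->
    (forall n : M, sat (scons n e) E p -> sat (scons (add n one) e) E p) ->
    forall n : M, sat (scons n e) E p.

Definition Delta01_comprehension (M : L2structure) : Prop :=
  forall (p q : form) (e : nat -> M) (E : nat -> M -> Prop),
    Sigma01 p -> Pi01 q -> (forall i, is_set (E i)) ->
    (forall n : M, sat (scons n e) E p <-> sat (scons n e) E q) ->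
    exists X : M -> Prop,
      is_set X /\ forall n : M, X n <-> sat (scons n e) E p.

Record RCA0 (M : L2structure) : Prop := MkRCA0 {
  RCA0_basic : basic_axioms M;
  RCA0_induction : Sigma01_induction M;
  RCA0_comprehension : Delta01_comprehension M
}.

Definition arithmetic_comprehension (M : L2structure) : Prop :=
  forall (p : form) (e : nat -> M) (E : nat -> M -> Prop),
    arithmetical p -> (forall i, is_set (E i)) ->
    exists X : M -> Prop,
      is_set X /\ forall n : M, X n <-> sat (scons n e) E p.

(** * Lex-Indec inside a structure *)

(* The pairing (i, j) = (i + j)^2 + i. *)
Definition cpair (M : L2structure) (i j : M) : M :=
  add (mul (add i j) (add i j)) i.

(* (x_1, ..., x_n) is coded by ((...((x_1, x_2), x_3), ...), x_n). *)
Definition tcode (M : L2structure) (n : nat) (x : n.-tuple M) : M :=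
  if tval x is a :: s then foldl (@cpair M) a s else zero.

Definition numeral (M : L2structure) (k : nat) : M :=
  iter k (fun m => add m one) zero.

Definition power (M : L2structure) (n : nat) : M -> Prop :=
  fun a => exists x : n.-tuple M, a = tcode x.

Definition below (M : L2structure) (k : nat) : M -> Prop :=
  fun a => lt a (numeral M k).

(* F, regarded as a set of pairs, is a function from A to B. *)
Definition is_fun (M : L2structure) (A B F : M -> Prop) : Prop :=
  [/\ forall z : M, F z -> exists a b : M, [/\ A a, B b & z = cpair a b],
      forall a b b' : M, F (cpair a b) -> F (cpair a b') -> b = b'
    & forall a : M, A a -> exists b : M, B b /\ F (cpair a b)].

Definition lexlt (M : L2structure) (n : nat) (x y : n.-tuple M) : Prop :=
  exists i : 'I_n,
    (forall j : 'I_n, j < i -> tnth x j = tnth y j) /\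
    lt (tnth x i) (tnth y i).

Definition lex_embedding (M : L2structure) (n : nat) (h : M -> Prop) : Prop :=
  is_fun (power n) (power n) h /\
  forall x x' y y' : n.-tuple M,
    h (cpair (tcode x) (tcode y)) -> h (cpair (tcode x') (tcode y')) ->
    lexlt x x' -> lexlt y y'.

Definition LexIndec (n k : nat) (M : L2structure) : Prop :=
  forall c : M -> Prop,
    is_set c -> is_fun (power n) (below k) c ->
    exists h : M -> Prop,
      [/\ is_set h, lex_embedding n h
        & exists i : M, forall x y : n.-tuple M,
            h (cpair (tcode x) (tcode y)) -> c (cpair (tcode y) i)].

(* Main.v *)
(* Let X be a set and K = {n : exists s, X (n, s)}.  Colour (x, y, z) with 1 iff
   every n < x that enters K before stage z already enters it before stage y, and
   let h = (h1, h2, h3) be a lexicographic embedding with monochromatic image.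
   Comparing lexicographic growth with bounds on the coordinates shows that
   h1 (x, 0, 0) >= x, that h2 (0, y, 0) is unbounded in y, and that for each x
   some y has h1 (x, y, 0) = h1 (x, y + 1, 0), in which case h3 (x, y, z) is
   unbounded in z while h2 (x, y, z) <= h2 (x, y + 1, 0).
   Colour 0 is impossible, because the elements of K below a fixed number have all
   entered by some stage (strong Sigma_1 bounding).  With colour 1, n is in K iff it
   enters before stage h2 (n + 1, y + 1, 0), for one or for all y such that
   h1 (n + 1, y, 0) = h1 (n + 1, y + 1, 0); so K is Delta_1 in h and X.  Closure
   under existential quantification gives all arithmetical sets. *)

From Stdlib Require Import Ring Classical IndefiniteDescription.
From Stdlib Require Import FunctionalExtensionality PropExtensionality.
From mathcomp Require Import all_boot.
Require Import Defs.

Set Implicit Arguments.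
Unset Strict Implicit.
Unset Printing Implicit Defensive.

Declare Scope so_scope.

(** In the induction lemmas variable 0 is a witness or dummy and variable 1 the induction variable,
    so a parameter list prepended to [e] starts at [tvar 2]. *)
Definition prepend (A : Type) (s : seq A) (e : nat -> A) : nat -> A :=
  foldr (@scons A) e s.

Definition tpair (s t : term) : term :=
  tadd (tmul (tadd s t) (tadd s t)) s.

Definition ttriple (r s t : term) : term := tpair (tpair r s) t.

Section Model.

Context (M : L2structure) (RM : RCA0 M).

Local Notation "x + y" := (@add M x y) : so_scope.
Local Notation "x * y" := (@mul M x y) : so_scope.
Local Notation "x < y" := (@lt M x y) : so_scope.
Local Notation "0" := (@zero M) : so_scope.
Local Notation "1" := (@one M) : so_scope.
Local Open Scope so_scope.
Implicit Types (a b c d k m n q r s t u v w x y z : M) (e : nat -> M).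

Let ax := RCA0_basic RM.

(** * Induction *)

(* Number variable 0 of [p] is the witness of the unbounded quantifier; when the
   predicate is bounded, as in [Delta_ind] and [Delta_comp], it is a dummy. *)
Lemma Sigma_ind (R : M -> Prop) p e (E : nat -> M -> Prop) :
    bounded p -> (forall i, is_set (E i)) ->
    (forall n, (exists m, sat (scons m (scons n e)) E p) <-> R n) ->
  R 0 -> (forall n, R n -> R (n + 1)) -> forall n, R n.
Proof.
move=> bp sE pR R0 RS n; apply/pR.
apply: (RCA0_induction RM (p := fex p)) => //=; first exact/pR.
by move=> k /pR Rk; apply/pR/RS.
Qed.

Lemma Delta_ind (R : M -> Prop) p e :
    bounded p ->
    (forall E m n, sat (scons m (scons n e)) E p <-> R n) ->
  R 0 -> (forall n, R n -> R (n + 1)) -> forall n, R n.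
Proof.
move=> bp pR; have [X sX] := set_inhabited M.
apply: (@Sigma_ind R p e (fun=> X)) => // n.
by split=> [[m /pR]|Rn] //; exists 0; apply/pR.
Qed.

Lemma Delta_comp (R : M -> Prop) p e (E : nat -> M -> Prop) :
    bounded p -> (forall i, is_set (E i)) ->
    (forall m n, sat (scons m (scons n e)) E p <-> R n) ->
  exists X : M -> Prop, is_set X /\ forall n, X n <-> R n.
Proof.
move=> bp sE pR.
have exR n : sat (scons n e) E (fex p) <-> R n.
  by split=> [[m /pR]|Rn] //; exists 0; apply/pR.
have allR n : sat (scons n e) E (fex p) <-> sat (scons n e) E (fall p).
  by rewrite exR; split=> [Rn m|/(_ 0)/pR //]; apply/pR.
have [X [sX XE]] :=
  RCA0_comprehension RM (Sigma01_ex bp) (Pi01_all bp) sE allR.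
by exists X; split=> // n; rewrite XE.
Qed.

(** * Arithmetic *)

Lemma addn0m n : 0 + n = n.
Proof.
apply: (@Delta_ind (fun n => 0 + n = n)
  (feq (tadd tzero (tvar 1)) (tvar 1)) (fun=> 0)) => //=.
- by constructor.
- exact: add_zero.
- by move=> k IH; rewrite add_succ // IH.
Qed.

Lemma addSm m n : (m + 1) + n = (m + n) + 1.
Proof.
apply: (@Delta_ind (fun n => (m + 1) + n = (m + n) + 1)
  (feq (tadd (tadd (tvar 2) tone) (tvar 1)) (tadd (tadd (tvar 2) (tvar 1)) tone))
  (prepend [:: m] (fun=> 0))) => //=.
- by constructor.
- by rewrite !add_zero.
- by move=> k IH; rewrite !add_succ // IH.
Qed.

Lemma addC m n : m + n = n + m.
Proof.
apply: (@Delta_ind (fun n => m + n = n + m)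
  (feq (tadd (tvar 2) (tvar 1)) (tadd (tvar 1) (tvar 2)))
  (prepend [:: m] (fun=> 0))) => //=.
- by constructor.
- by rewrite add_zero // addn0m.
- by move=> k IH; rewrite add_succ // addSm IH.
Qed.

Lemma addA m n k : m + (n + k) = (m + n) + k.
Proof.
apply: (@Delta_ind (fun k => m + (n + k) = (m + n) + k)
  (feq (tadd (tvar 2) (tadd (tvar 3) (tvar 1)))
       (tadd (tadd (tvar 2) (tvar 3)) (tvar 1)))
  (prepend [:: m; n] (fun=> 0))) => //=.
- by constructor.
- by rewrite !add_zero.
- by move=> l IH; rewrite !add_succ // IH.
Qed.

Lemma mul0m n : 0 * n = 0.
Proof.
apply: (@Delta_ind (fun n => 0 * n = 0)
  (feq (tmul tzero (tvar 1)) tzero) (fun=> 0)) => //=.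
- by constructor.
- exact: mul_zero.
- by move=> k IH; rewrite mul_succ // IH add_zero.
Qed.

Lemma mulSm m n : (m + 1) * n = m * n + n.
Proof.
apply: (@Delta_ind (fun n => (m + 1) * n = m * n + n)
  (feq (tmul (tadd (tvar 2) tone) (tvar 1)) (tadd (tmul (tvar 2) (tvar 1)) (tvar 1)))
  (prepend [:: m] (fun=> 0))) => //=.
- by constructor.
- by rewrite !mul_zero ?add_zero.
- move=> k IH; rewrite !mul_succ // IH !add_succ //.
  by rewrite -!addA (addA k) (addC k m) -addA.
Qed.

Lemma mulC m n : m * n = n * m.
Proof.
apply: (@Delta_ind (fun n => m * n = n * m)
  (feq (tmul (tvar 2) (tvar 1)) (tmul (tvar 1) (tvar 2)))
  (prepend [:: m] (fun=> 0))) => //=.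
- by constructor.
- by rewrite mul_zero // mul0m.
- by move=> k IH; rewrite mul_succ // mulSm IH.
Qed.

Lemma mulDl m n k : (m + n) * k = m * k + n * k.
Proof.
apply: (@Delta_ind (fun k => (m + n) * k = m * k + n * k)
  (feq (tmul (tadd (tvar 2) (tvar 3)) (tvar 1))
       (tadd (tmul (tvar 2) (tvar 1)) (tmul (tvar 3) (tvar 1))))
  (prepend [:: m; n] (fun=> 0))) => //=.
- by constructor.
- by rewrite !mul_zero ?add_zero.
- move=> l IH; rewrite !mul_succ // IH -!addA.
  by rewrite (addA _ m n) (addC _ m) !addA.
Qed.

Lemma mulA m n k : m * (n * k) = (m * n) * k.
Proof.
apply: (@Delta_ind (fun k => m * (n * k) = (m * n) * k)
  (feq (tmul (tvar 2) (tmul (tvar 3) (tvar 1)))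
       (tmul (tmul (tvar 2) (tvar 3)) (tvar 1)))
  (prepend [:: m; n] (fun=> 0))) => //=.
- by constructor.
- by rewrite !mul_zero.
- move=> l IH; rewrite !mul_succ // -IH.
  by rewrite mulC mulDl !(mulC _ m).
Qed.

Lemma mul1m n : 1 * n = n.
Proof. by rewrite -[1]addn0m mulSm mul0m addn0m. Qed.

Lemma semi_ring_M : semi_ring_theory 0 1 (@add M) (@mul M) (@eq M).
Proof.
split; [exact: addn0m|exact: addC|exact: addA|exact: mul1m|exact: mul0m
       |exact: mulC|exact: mulA|exact: mulDl].
Qed.

Add Ring M_ring : semi_ring_M.

(** * Cancellation, predecessors and the order *)

Lemma addIm k m n : m + k = n + k -> m = n.
Proof.
apply: (@Delta_ind (fun k => m + k = n + k -> m = n)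
  (fimp (feq (tadd (tvar 2) (tvar 1)) (tadd (tvar 3) (tvar 1)))
        (feq (tvar 2) (tvar 3)))
  (prepend [:: m; n] (fun=> 0))) => //=.
- by repeat constructor.
- by rewrite !add_zero.
- by move=> l IH; rewrite !add_succ // => /(succ_inj ax).
Qed.

Lemma addmI k m n : k + m = k + n -> m = n.
Proof. by rewrite !(addC k); apply: addIm. Qed.

Lemma zero_or_succ n : n = 0 \/ exists k, n = k + 1.
Proof.
(* Bounding the predecessor by [n] gives a bounded predicate, as [Delta_ind] requires. *)
pose R n := n = 0 \/ exists k, k < n /\ n = k + 1.
suff: R n by case=> [|[k []]]; [left | right; exists k].
apply: (@Delta_ind R
  (for_ (feq (tvar 1) tzero)
     (fexb (tvar 1) (feq (tvar 2) (tadd (tvar 0) tone)))) (fun=> 0)) => //=.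
- by repeat constructor.
- by left.
- by move=> k _; right; exists k; split=> //; apply/lt_succ; [|right].
Qed.

(** Witnessed by a difference, so that many inequalities become identities for [ring]; [ltE] links
    it to the primitive [lt]. *)
Definition le m n := exists k, n = m + k.
Local Notation "x <= y" := (le x y) : so_scope.

Lemma add_eq0 m n : m + n = 0 -> n = 0.
Proof.
case: (zero_or_succ n) => [->|[k ->]] //.
by rewrite add_succ // => /(succ_neq0 ax).
Qed.

Lemma lt_add m k : m < m + (k + 1).
Proof.
apply: (@Delta_ind (fun k => m < m + (k + 1))
  (flt (tvar 2) (tadd (tvar 2) (tadd (tvar 1) tone)))
  (prepend [:: m] (fun=> 0))) => //=.
- by constructor.
- by rewrite addn0m; apply/lt_succ; [|right].
- by move=> l IH; rewrite add_succ //; apply/lt_succ; [|left].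
Qed.

Lemma ltE m n : m < n <-> m + 1 <= n.
Proof.
split=> [|[k ->]]; last first.
  by have := lt_add m k; congr (_ < _); ring.
(* The difference is bounded by [n] to keep the induction formula bounded. *)
pose R n := m < n -> exists k, k < n /\ n = (m + 1) + k.
suff: R n by move=> Rn /Rn [k []]; exists k.
apply: (@Delta_ind R
  (fimp (flt (tvar 2) (tvar 1))
     (fexb (tvar 1) (feq (tvar 2) (tadd (tadd (tvar 3) tone) (tvar 0)))))
  (prepend [:: m] (fun=> 0))) => //=.
- by repeat constructor.
- by move/(not_lt_zero ax).
- move=> l IH /(lt_succ ax) [/IH [k [ltkl ->]]|<-].
    exists (k + 1); split; last by ring.
    have := lt_add (k + 1) m; congr (_ < _); ring.
  exists 0; split; last by ring.
  by have := lt_add 0 m; congr (_ < _); ring.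
Qed.

Lemma le_refl m : m <= m.
Proof. by exists 0; ring. Qed.

Lemma le_trans n m k : m <= n -> n <= k -> m <= k.
Proof. by move=> [a ->] [b ->]; exists (a + b); ring. Qed.

Lemma le_anti m n : m <= n -> n <= m -> m = n.
Proof.
move=> [a ->] [b /esym eqm].
have /add_eq0 b0 : a + b = 0 by apply: (@addmI m); rewrite addA eqm add_zero.
by move: eqm; rewrite b0 add_zero // => ->.
Qed.

Lemma le_addr m k : m <= m + k.
Proof. by exists k. Qed.

Lemma le_addl m k : m <= k + m.
Proof. by exists k; ring. Qed.

Lemma le0m m : 0 <= m.
Proof. by exists m; ring. Qed.

Lemma le_add m n a b : m <= n -> a <= b -> m + a <= n + b.
Proof. by move=> [k ->] [l ->]; exists (k + l); ring. Qed.

Lemma le_mul m n a b : m <= n -> a <= b -> m * a <= n * b.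
Proof.
by move=> [k ->] [l ->]; exists (m * l + k * a + k * l); ring.
Qed.

Lemma le_addI m n k : m + k <= n + k -> m <= n.
Proof.
by move=> [l eql]; exists l; apply: (@addIm k); rewrite eql; ring.
Qed.

Lemma lt_irr m : ~ m < m.
Proof.
move=> /ltE [k eqm]; have: 0 = k + 1 by apply: (@addmI m); rewrite {1}eqm; ring.
exact/nesym/succ_neq0.
Qed.

Lemma ltW m n : m < n -> m <= n.
Proof. by move=> /ltE [k ->]; exists (1 + k); ring. Qed.

Lemma lt_leT n m k : m < n -> n <= k -> m < k.
Proof. by move=> /ltE mn nk; apply/ltE/(le_trans mn). Qed.

Lemma le_ltT n m k : m <= n -> n < k -> m < k.
Proof.
move=> mn /ltE nk; apply/ltE/(le_trans _ nk).
exact/le_add/le_refl.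
Qed.

Lemma lt_ltT n m k : m < n -> n < k -> m < k.
Proof. by move=> mn /ltW; apply: lt_leT. Qed.

Lemma ltS m n : m < n + 1 <-> m <= n.
Proof. by rewrite ltE; split=> [/le_addI|mn] //; apply/le_add/le_refl. Qed.

Lemma lt0S m : 0 < m + 1.
Proof. exact/ltS/le0m. Qed.

Lemma le_lteq m n : m <= n <-> m < n \/ m = n.
Proof. by rewrite -ltS; apply: lt_succ. Qed.

Lemma lt_total m n : m < n \/ m = n \/ n < m.
Proof.
apply: (@Delta_ind (fun n => m < n \/ m = n \/ n < m)
  (for_ (flt (tvar 2) (tvar 1))
     (for_ (feq (tvar 2) (tvar 1)) (flt (tvar 1) (tvar 2))))
  (prepend [:: m] (fun=> 0))) => //=.
- by repeat constructor.
- by case: (zero_or_succ m) => [->|[k ->]]; right; [left|right; apply: lt0S].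
- move=> l [mn|[->|/ltE/le_lteq [mn|->]]].
  + by left; apply/ltS/ltW.
  + by left; apply/ltS/le_refl.
  + by right; right.
  + by right; left.
Qed.

Lemma le_or_lt m n : m <= n \/ n < m.
Proof.
by case: (lt_total m n) => [/ltW|[->|]]; [left|left; apply: le_refl|right].
Qed.

Lemma notlt m n : ~ m < n -> n <= m.
Proof. by case: (le_or_lt n m). Qed.

Lemma le_mulS m k : m <= (k + 1) * m.
Proof. by exists (k * m); ring. Qed.

Lemma le_mul_self m : m <= m * m.
Proof.
case: (zero_or_succ m) => [->|[k ->]]; first exact: le0m.
exact: le_mulS.
Qed.

(** * Pairing *)

Lemma le_cpair1 m n : m <= cpair m n.
Proof. exact: le_addl. Qed.

Lemma le_cpair2 m n : n <= cpair m n.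
Proof.
apply: (@le_trans (m + n)); first exact: le_addl.
by apply: le_trans (le_mul_self _) (le_addr _ _).
Qed.

(** With s = m + n, the code lies between s^2 and s^2 + s, hence below (s + 1)^2. *)
Lemma cpair_lt m n m' n' : m + n < m' + n' -> cpair m n < cpair m' n'.
Proof.
move=> lt_s; apply: (@lt_leT ((m' + n') * (m' + n'))); last exact: le_addr.
move: lt_s => /ltE le_s; apply: (lt_leT _ (le_mul le_s le_s)).
by apply/ltE; exists (m + n + n); rewrite /cpair; ring.
Qed.

Lemma cpair_inj m n m' n' : cpair m n = cpair m' n' -> m = m' /\ n = n'.
Proof.
move=> eqp; have eqs : m + n = m' + n'.
  by case: (lt_total (m + n) (m' + n')) => [/cpair_lt|[//|/cpair_lt]];
    rewrite eqp => /lt_irr.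
have eqm : m = m' by move: eqp; rewrite /cpair eqs => /addmI.
by split=> //; move: eqs; rewrite eqm => /addmI.
Qed.

(** * Strong bounding *)

Definition dvd m n := exists k, n = m * k.

Lemma dvd_mull d m k : dvd d m -> dvd d (k * m).
Proof. by move=> [q ->]; exists (k * q); ring. Qed.

Lemma dvd_mulr d m k : dvd d m -> dvd d (m * k).
Proof. by rewrite mulC; apply: dvd_mull. Qed.

Lemma dvd_addI d m n : dvd d m -> dvd d (m + n) -> dvd d n.
Proof.
move=> [q ->] [r eqr]; have [[t eqt]|/ltE [t eqt]] := le_or_lt q r.
  by exists t; apply: (@addmI (d * q)); rewrite eqr eqt; ring.
exists 0; rewrite mul_zero //; apply: (@add_eq0 (d * (1 + t))).
by apply: (@addmI (d * r)); rewrite add_zero // -{2}eqr eqt; ring.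
Qed.

(** For a nonzero divisor the quotient is at most [m], which makes divisibility a bounded
    formula. *)
Lemma dvdSP d m :
  dvd (d + 1) m <-> exists w, w < m + 1 /\ m = (d + 1) * w.
Proof.
split=> [[w ->]|[w [_ ->]]]; exists w => //.
by split=> //; apply/ltS/le_mulS.
Qed.

(** The moduli of Goedel's beta function, used twice: [c = 0], [v = 1] gives n + 1, and [c = v]
    gives 1 + (n + 1) v. *)
Definition modulus c v n := c + n * v + 1.

(** One modulus is multiplied in at a time; Sigma_1 induction with the multiple as witness takes the
    place of coded products. *)
Lemma common_multiple c v a :
  exists m, 0 < m /\ forall n, n < a -> dvd (modulus c v n) m.
Proof.
have [X sX] := set_inhabited M.
apply: (@Sigma_ind (fun a => exists m, 0 < m /\
    forall n, n < a -> dvd (modulus c v n) m)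
  (fand (flt tzero (tvar 0))
     (fallb (tvar 1) (fexb (tadd (tvar 1) tone) (feq (tvar 2)
        (tmul (tadd (tadd (tvar 4) (tmul (tvar 1) (tvar 5))) tone) (tvar 0))))))
  (prepend [:: c; v] (fun=> 0)) (fun=> X)) => //=.
- by repeat constructor.
- by move=> n; split=> -[m [m0 dvdm]]; exists m; split=> // k /dvdm /dvdSP.
- exists 1; split; first by rewrite -(addn0m 1); apply: lt0S.
  by move=> n /(not_lt_zero ax).
- move=> l [m [m0 dvdm]]; exists (m * modulus c v l); split.
    move: m0; rewrite /modulus; case: (zero_or_succ m) => [-> /lt_irr //|[k ->] _].
    apply: (lt_leT (lt0S _)); rewrite mulC; exact: le_mulS.
  move=> n /(lt_succ ax) [/dvdm|->]; first exact: dvd_mulr.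
  by apply: dvd_mull; exists 1; ring.
Qed.

(* Since [v] is a multiple of the difference of any two indices below [a], the
   moduli [modulus v v n = 1 + (n + 1) * v] are pairwise coprime. *)
Lemma modulus_Gauss a v n k q :
    (forall i, i < a -> dvd (i + 1) v) -> n < a -> k < a -> n <> k ->
  dvd (modulus v v n) (modulus v v k * q) -> dvd (modulus v v n) q.
Proof.
move=> dvdv na ka neq_nk dvdq.
(* [j + 1] will be the distance between [n] and [k]. It divides [v], and (n + 1) v is -1 modulo
   [modulus v v n], so it can be cancelled. *)
have gap j : j < a -> dvd (modulus v v n) ((j + 1) * q) -> dvd (modulus v v n) q.
  move=> /dvdv [t eqv] dvdj; apply: (@dvd_addI _ ((n + 1) * t * ((j + 1) * q))).
    exact: dvd_mull.
  by exists q; rewrite /modulus eqv; ring.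
(* Both cases rest on (n + 1) (1 + (k + 1) v) and (k + 1) (1 + (n + 1) v) differing by the distance
   between [n] and [k]. *)
have [/ltE [j eqk]|[//|/ltE [j eqn]]] := lt_total n k.
  have ja : j < a by apply: le_ltT ka; rewrite eqk; exact: le_addl.
  apply: (gap j ja); apply: (@dvd_addI _ ((n + 1) * (modulus v v k * q))).
    exact: dvd_mull.
  by exists ((k + 1) * q); rewrite /modulus eqk; ring.
have ja : j < a by apply: le_ltT na; rewrite eqn; exact: le_addl.
apply: (gap j ja); apply: (@dvd_addI _ ((k + 1) * q * modulus v v n)).
  by exists ((k + 1) * q); ring.
have [r eqr] := dvdq; exists ((n + 1) * r).
transitivity ((n + 1) * (modulus v v k * q)); last by rewrite eqr; ring.
by rewrite /modulus eqn; ring.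
Qed.

(* If there were no bound, then starting from a common multiple of all moduli
   one could divide out a new modulus again and again. *)
Lemma strong_bounding (X : M -> Prop) a : is_set X ->
  exists b, forall n s, n < a -> X (cpair n s) ->
    exists t, t < b /\ X (cpair n t).
Proof.
move=> sX; apply: NNPP => nobound.
have late b : exists n s, [/\ n < a, X (cpair n s)
    & forall t, t < b -> ~ X (cpair n t)].
  apply: NNPP => nolate; apply: nobound; exists b => n s na Xns.
  apply: NNPP => noearly; apply: nolate; exists n, s; split=> // t tb Xnt.
  by apply: noearly; exists t.
(* [v] is a multiple of 1, ..., [a], and [D] of all moduli with index below [a]. *)
have [v [v0 dvdv]] := common_multiple 0 1 a.
have {}dvdv i : i < a -> dvd (i + 1) v.
  by move=> /dvdv; congr (dvd _ _); rewrite /modulus; ring.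
have [D [D0 dvdD]] := common_multiple v v a.
(* State after [i] divisions: m + i is at most [D], and the modulus of each [n < a] without a
   witness below [b] still divides [m]. At i = D no positive [m] is left. *)
pose R i := exists m b, [/\ 0 < m, m + i < D + 1 & forall n, n < a ->
  (exists s, s < b /\ X (cpair n s)) \/ dvd (modulus v v n) m].
suff /(_ D) [m [b [m0 /ltS /(lt_leT _) lt_m _]]] : forall i, R i.
  apply: (@lt_irr D); apply: lt_m; apply/ltE.
  by case: (zero_or_succ m) m0 => [-> /lt_irr //|[k ->] _]; exists k; ring.
apply: (@Sigma_ind R
  (fexb (tvar 0) (fexb (tvar 1)
    (fand (flt tzero (tvar 1))
    (fand (flt (tadd (tvar 1) (tvar 3)) (tadd (tvar 6) tone))
    (fallb (tvar 4) (for_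
      (fexb (tvar 1) (fmem (tpair (tvar 1) (tvar 0)) 0))
      (fexb (tadd (tvar 2) tone) (feq (tvar 3)
        (tmul (tadd (tadd (tvar 7) (tmul (tvar 1) (tvar 7))) tone)
           (tvar 0))))))))))
  (prepend [:: a; v; D] (fun=> 0)) (fun=> X)) => //=.
- by repeat constructor.
- move=> i; split=> [[u [m [_ [b [_ [m0 [lem H]]]]]]]|[m [b [m0 lem H]]]].
    exists m, b; split=> // n /H [|/dvdSP]; by [left|right].
  (* A single unbounded witness bounds both [m] and [b]. *)
  exists (m + b + 1); exists m; split; first exact/ltS/le_addr.
  exists b; split; first exact/ltS/le_addl.
  by do 2!split=> //; move=> n /H [|/dvdSP]; by [left|right].
- exists D, 0; split=> //; first by apply/ltS; exists 0; ring.
  by move=> n /dvdD; right.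
- move=> i [m [b [m0 lem H]]].
  (* This [n] has no witness below [b], so its modulus divides [m]; it is divided out and the stage
     is raised past [s]. *)
  have [n [s [na Xns before]]] := late b.
  have [[t [/before //]]|[w eqm]] := H n na.
  exists w, (b + s + 1); split.
  + case: (zero_or_succ w) eqm => [->|[k ->] _]; last exact: lt0S.
    by rewrite mul_zero // => eqm; move: m0; rewrite eqm => /lt_irr.
  + apply: le_ltT lem; apply: (@le_trans ((w + 1) + i)); first by exists 0; ring.
    apply: le_add (le_refl i).
    (* As [v] is positive, the modulus is at least 2 and the quotient drops strictly. *)
    have [k eqv] : exists k, v = k + 1.
      by case: (zero_or_succ v) v0 => // -> /lt_irr.
    case: (zero_or_succ w) eqm => [->|[l ->] ->].
      by rewrite mul_zero // => eqm; move: m0; rewrite eqm => /lt_irr.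
    rewrite /modulus eqv; exists (k * (l + 1) + n * (k + 1) * (l + 1) + l); ring.
  + move=> k ka; have [<-|neq_kn] := classic (n = k).
      by left; exists s; split=> //; apply/ltS/le_addl.
    have [[t [tb Xkt]]|dvdm] := H k ka.
      left; exists t; split=> //; apply: (lt_leT tb).
      by exists (s + 1); ring.
    right; apply: (@modulus_Gauss a v k n w) => //; first exact: nesym.
    by rewrite -eqm.
Qed.

(** * Lexicographic embeddings of triples *)

Definition triple x y z := cpair (cpair x y) z.

Lemma triple_inj x y z x' y' z' :
  triple x y z = triple x' y' z' -> [/\ x = x', y = y' & z = z'].
Proof. by move=> /cpair_inj [/cpair_inj [-> ->] ->]. Qed.

Lemma power3P w : power 3 w <-> exists x y z, w = triple x y z.
Proof.
split=> [[[[|x [|y [|z [|? ?]]]] //= sz] ->]|[x [y [z ->]]]]; first by exists x, y, z.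
by exists [tuple x; y; z].
Qed.

Definition lex3 x y z x' y' z' :=
  x < x' \/ x = x' /\ (y < y' \/ y = y' /\ z < z').

Lemma lexlt3P x y z x' y' z' :
  lexlt [tuple x; y; z] [tuple x'; y'; z'] <-> lex3 x y z x' y' z'.
Proof.
split=> [[[[|[|[|k]]] //= lti] [eqj ltj]]|[ltx|[eqx [lty|[eqy ltz]]]]].
- by left.
- right; split; first exact: (eqj (@Ordinal 3 0 isT)).
  by left.
- right; split; first exact: (eqj (@Ordinal 3 0 isT)).
  right; split; first exact: (eqj (@Ordinal 3 1 isT)).
  exact: ltj.
- by exists (@Ordinal 3 0 isT); split.
- by exists (@Ordinal 3 1 isT); split=> // -[[|k] lti].
- by exists (@Ordinal 3 2 isT); split=> // -[[|[|k]] lti].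
Qed.

Definition is_graph (h : M -> Prop) (h1 h2 h3 : M -> M -> M -> M) :=
  forall x y z a b c, h (cpair (triple x y z) (triple a b c)) <->
    [/\ a = h1 x y z, b = h2 x y z & c = h3 x y z].

Definition lex_mono (h1 h2 h3 : M -> M -> M -> M) :=
  forall x y z x' y' z', lex3 x y z x' y' z' ->
    lex3 (h1 x y z) (h2 x y z) (h3 x y z) (h1 x' y' z') (h2 x' y' z') (h3 x' y' z').

(** The coordinate functions are chosen in the metatheory; formulas refer to them only through the
    set [h]. *)
Lemma lex_embedding3 (h : M -> Prop) : lex_embedding 3 h ->
  exists h1 h2 h3, is_graph h h1 h2 h3 /\ lex_mono h1 h2 h3.
Proof.
move=> [[_ h_fun h_tot] h_mono].
have [p|f hf] := functional_choice
  (fun p q : M * M * M =>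
     h (cpair (triple p.1.1 p.1.2 p.2) (triple q.1.1 q.1.2 q.2))).
  have [|w [/power3P [a [b [c ->]]] hw]] := h_tot (triple p.1.1 p.1.2 p.2).
    by apply/power3P; exists p.1.1, p.1.2, p.2.
  by exists (a, b, c).
exists (fun x y z => (f (x, y, z)).1.1), (fun x y z => (f (x, y, z)).1.2),
  (fun x y z => (f (x, y, z)).2).
split=> [x y z a b c|x y z x' y' z' /lexlt3P ltxyz].
  split=> [hxyz|[-> -> ->]]; last exact: (hf (x, y, z)).
  exact/triple_inj/(h_fun _ _ _ hxyz (hf (x, y, z))).
apply/lexlt3P/h_mono/ltxyz; [exact: (hf (x, y, z))|exact: (hf (x', y', z'))].
Qed.

(** * Growth of the coordinates of a lexicographic embedding *)

Section Embedding.

Variables (h : M -> Prop) (h1 h2 h3 : M -> M -> M -> M).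
Hypothesis (sh : is_set h) (hP : is_graph h h1 h2 h3) (hmono : lex_mono h1 h2 h3).

(** Such a [g i] is a term in [i] and two parameters, so one formula covers both fixed and moving
    coordinates. *)
Definition affine (g : M -> M) := exists r s, forall i, g i = r + i * s.

Lemma affine_id : affine id.
Proof. by exists 0, 1 => i; ring. Qed.

Lemma affine_cst k : affine (fun=> k).
Proof. by exists k, 0 => i; ring. Qed.

(* All instances move one coordinate only; the weights [p], [q], [r] turn a
   lexicographic increase of bounded coordinates into a numerical one. *)
Lemma potential_unbounded p q r (gx gy gz : M -> M) :
    affine gx -> affine gy -> affine gz ->
  let phi i := h1 (gx i) (gy i) (gz i) * p + h2 (gx i) (gy i) (gz i) * q
               + h3 (gx i) (gy i) (gz i) * r in
  (forall i, phi i < phi (i + 1)) -> forall i, i <= phi i.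
Proof.
move=> [x0 [x1 gxE]] [y0 [y1 gyE]] [z0 [z1 gzE]] phi phiS.
apply: (@Sigma_ind (fun i => i <= phi i)
  (fexb (tvar 0) (fexb (tvar 1) (fexb (tvar 2) (fand
    (fmem (tpair
      (ttriple (tadd (tvar 8) (tmul (tvar 4) (tvar 9)))
               (tadd (tvar 10) (tmul (tvar 4) (tvar 11)))
               (tadd (tvar 12) (tmul (tvar 4) (tvar 13))))
      (ttriple (tvar 2) (tvar 1) (tvar 0))) 0)
    (flt (tvar 4) (tadd (tadd (tadd (tmul (tvar 2) (tvar 5))
      (tmul (tvar 1) (tvar 6))) (tmul (tvar 0) (tvar 7))) tone))))))
  (prepend [:: p; q; r; x0; x1; y0; y1; z0; z1] (fun=> 0)) (fun=> h)) => //=.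
- by repeat constructor.
- move=> i; rewrite -/(triple _ _ _).
  split=> [[u [a [_ [b [_ [c [_ [hi lti]]]]]]]]|lei].
    move: hi lti; rewrite -gxE -gyE -gzE => /hP [-> -> ->] /ltS; exact.
  set a := h1 (gx i) (gy i) (gz i).
  set b := h2 (gx i) (gy i) (gz i).
  set c := h3 (gx i) (gy i) (gz i).
  exists (a + b + c + 1).
  exists a; split; first by apply/ltS; exists (b + c); ring.
  exists b; split; first by apply/ltS; exists (a + c); ring.
  exists c; split; first by apply/ltS; exists (a + b); ring.
  split; last exact/ltS.
  by rewrite -gxE -gyE -gzE; apply/hP.
- exact: le0m.
- by move=> i lei; apply/ltE/(le_ltT lei).
Qed.

(** Growth at [B + 1] exceeds the bound; the later growth lemmas all reduce to this contradiction or
    to [potential_unbounded]. *)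
Lemma potential_bound_false p q r (gx gy gz : M -> M) B :
    affine gx -> affine gy -> affine gz ->
  let phi i := h1 (gx i) (gy i) (gz i) * p + h2 (gx i) (gy i) (gz i) * q
               + h3 (gx i) (gy i) (gz i) * r in
  (forall i, phi i < phi (i + 1)) -> (forall i, phi i <= B) -> False.
Proof.
move=> ax_ ay az phi phiS phiB.
have := potential_unbounded ax_ ay az phiS (B + 1).
by move=> /le_trans /(_ (phiB _)) /ltE /lt_irr.
Qed.

Lemma h1_le x y z x' y' z' : lex3 x y z x' y' z' -> h1 x y z <= h1 x' y' z'.
Proof.
by move=> /hmono [/ltW //|[-> _]]; apply: le_refl.
Qed.

Lemma h2_le x y z x' y' z' : lex3 x y z x' y' z' ->
  h1 x y z = h1 x' y' z' -> h2 x y z <= h2 x' y' z'.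
Proof.
move=> /hmono [lt1 eq1|[_ [/ltW //|[-> _ _]]]]; last exact: le_refl.
by move: lt1; rewrite eq1 => /lt_irr.
Qed.

Lemma h3_lt x y z x' y' z' : lex3 x y z x' y' z' ->
  h1 x y z = h1 x' y' z' -> h2 x y z = h2 x' y' z' -> h3 x y z < h3 x' y' z'.
Proof.
move=> /hmono [lt1 eq1|[_ [lt2 _ eq2|[_ lt3 //]]]].
  by move: lt1; rewrite eq1 => /lt_irr.
by move: lt2; rewrite eq2 => /lt_irr.
Qed.

Lemma lex3_z x y z : lex3 x y z x y (z + 1).
Proof. by right; split=> //; right; split=> //; apply/ltS/le_refl. Qed.

Lemma lex3_y x y z y' z' : y < y' -> lex3 x y z x y' z'.
Proof. by right; split=> //; left. Qed.

Lemma lex3_x x y z x' y' z' : x < x' -> lex3 x y z x' y' z'.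
Proof. by left. Qed.

Lemma ltSn n : n < n + 1.
Proof. exact/ltS/le_refl. Qed.

Lemma lex3_z0 x y z : z = 0 \/ lex3 x y 0 x y z.
Proof.
have [->|[k ->]] := zero_or_succ z; [by left | right].
by right; split=> //; right; split=> //; apply: lt0S.
Qed.

Lemma lex3_y0 x y z : y = 0 \/ lex3 x 0 z x y z.
Proof.
have [->|[k ->]] := zero_or_succ y; [by left | right].
exact/lex3_y/lt0S.
Qed.

(** The point (x, y, z) is squeezed between (x, y, 0) and (x, y + 1, 0). *)
Lemma h1_const_z x y z : h1 x y 0 = h1 x (y + 1) 0 -> h1 x y z = h1 x y 0.
Proof.
move=> eq1; have [->//|ltz] := lex3_z0 x y z.
apply: le_anti (h1_le ltz); rewrite eq1.
exact/h1_le/lex3_y/ltSn.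
Qed.

(** Otherwise [h1] and [h2] are constant along (x, y, _), where [h3] would increase strictly below
    [h3 x (y + 1) 0]. *)
Lemma h12_lt x y : h1 x y 0 < h1 x (y + 1) 0 \/
  h1 x y 0 = h1 x (y + 1) 0 /\ h2 x y 0 < h2 x (y + 1) 0.
Proof.
have [|[eq1 [|[eq2 _]]]] := hmono (@lex3_y x y 0 (y + 1) 0 (ltSn y));
  [by left|by right|exfalso].
have c1 z : h1 x y z = h1 x y 0 by apply: h1_const_z.
have c2 z : h2 x y z = h2 x y 0.
  have [->//|ltz] := lex3_z0 x y z.
  apply: le_anti; last by apply: h2_le ltz _; rewrite c1.
  rewrite eq2; apply: h2_le; first exact/lex3_y/ltSn.
  by rewrite c1.
apply: (@potential_bound_false 0 0 1 (fun=> x) (fun=> y) id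
  (h3 x (y + 1) 0)); try (exact: affine_cst || exact: affine_id).
  move=> z; rewrite !c1 !c2; have : h3 x y z < h3 x y (z + 1).
    by apply: h3_lt (lex3_z x y z) _ _; rewrite ?c1 ?c2.
  by move=> /ltE [k eqk]; apply/ltE; exists k; rewrite eqk; ring.
move=> z; have : h3 x y z < h3 x (y + 1) 0.
  apply: h3_lt; [exact/lex3_y/ltSn|by rewrite c1|by rewrite c2].
by move=> /ltW [k ->]; exists k; ring.
Qed.

(** Otherwise [h1] is constant along (x, _, 0), where by [h12_lt] [h2] would increase strictly and
    stay bounded by [h2 (x + 1) 0 0]. *)
Lemma h1_lt x : h1 x 0 0 < h1 (x + 1) 0 0.
Proof.
have [//|[eq1 _]] := hmono (@lex3_x x 0 0 (x + 1) 0 0 (ltSn x)); exfalso.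
have c1 y : h1 x y 0 = h1 x 0 0.
  have [->//|lty] := lex3_y0 x y 0.
  apply: le_anti (h1_le lty); rewrite eq1.
  exact/h1_le/lex3_x/ltSn.
apply: (@potential_bound_false 0 1 0 (fun=> x) id (fun=> 0)
  (h2 (x + 1) 0 0)); try (exact: affine_cst || exact: affine_id).
  move=> y; have [|[_]] := h12_lt x y; first by rewrite !c1 => /lt_irr.
  by move=> /ltE [k eqk]; apply/ltE; exists k; rewrite eqk; ring.
move=> y; have : h2 x y 0 <= h2 (x + 1) 0 0.
  by apply: h2_le; [exact/lex3_x/ltSn|rewrite c1].
by move=> [k ->]; exists k; ring.
Qed.

Lemma h1_ge x : x <= h1 x 0 0.
Proof.
have := @potential_unbounded 1 0 0 id (fun=> 0) (fun=> 0)
  affine_id (affine_cst 0) (affine_cst 0) _ x.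
case=> [y|k eqx]; last by exists k; rewrite -eqx; ring.
by have /ltE [k eqk] := h1_lt y; apply/ltE; exists k; rewrite eqk; ring.
Qed.

(** Otherwise [h1 x y 0] would increase strictly in [y], bounded by [h1 (x + 1) 0 0]. *)
Lemma h1_stable x : exists y, h1 x y 0 = h1 x (y + 1) 0.
Proof.
apply: NNPP => nostable.
apply: (@potential_bound_false 1 0 0 (fun=> x) id (fun=> 0)
  (h1 (x + 1) 0 0)); try (exact: affine_cst || exact: affine_id).
  move=> y; have [|[eq1 _]] := h12_lt x y; last by case: nostable; exists y.
  by move=> /ltE [k eqk]; apply/ltE; exists k; rewrite eqk; ring.
move=> y; have : h1 x y 0 <= h1 (x + 1) 0 0 by apply/h1_le/lex3_x/ltSn.
by move=> [k ->]; exists k; ring.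
Qed.

Lemma h2_bound x y z : h1 x y 0 = h1 x (y + 1) 0 -> h2 x y z <= h2 x (y + 1) 0.
Proof.
move=> eq1; apply: h2_le; first exact/lex3_y/ltSn.
by rewrite h1_const_z.
Qed.

(** Two-digit comparison in base s + 1; only the last digit of the smaller number has to be at most
    [s]. *)
Lemma lex_potential b c b' c' s : c <= s ->
  b < b' \/ b = b' /\ c < c' -> b * (s + 1) + c < b' * (s + 1) + c'.
Proof.
move=> [k ->] [/ltE [l ->]|[-> /ltE [l ->]]]; apply/ltE.
  exists (k + l * (c + k + 1) + c'); ring.
by exists l; ring.
Qed.

(** If [h3] stayed at most [s], then h2 (s + 1) + h3 would increase strictly in [z], yet [h2_bound]
    bounds it. *)
Lemma h3_unbounded x y s : h1 x y 0 = h1 x (y + 1) 0 -> exists z, s < h3 x y z.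
Proof.
move=> eq1; apply: NNPP => nolarge.
have le3 z : h3 x y z <= s by apply: notlt => lt3; apply: nolarge; exists z.
have c1 z : h1 x y z = h1 x y 0 by apply: h1_const_z.
apply: (@potential_bound_false 0 (s + 1) 1 (fun=> x) (fun=> y) id
  (h2 x (y + 1) 0 * (s + 1) + s)); try (exact: affine_cst || exact: affine_id).
  move=> z; have := hmono (lex3_z x y z); rewrite !c1 => -[/lt_irr //|[_]].
  move=> /(lex_potential (le3 z)) /ltE [k eqk]; apply/ltE; exists k.
  by rewrite !mul_zero // !addn0m !(mulC _ 1) !mul1m eqk.
move=> z; have [k eqk] := le_add (le_mul (h2_bound z eq1) (le_refl (s + 1))) (le3 z).
by exists k; rewrite eqk; ring.
Qed.

(** The same argument one coordinate up, with h1 (s + 1) + h2 and the bound [h1 (x + 1) 0 0]. *)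
Lemma h2_unbounded x s : exists y, s < h2 x y 0.
Proof.
apply: NNPP => nolarge.
have le2 y : h2 x y 0 <= s by apply: notlt => lt2; apply: nolarge; exists y.
apply: (@potential_bound_false (s + 1) 1 0 (fun=> x) id (fun=> 0)
  (h1 (x + 1) 0 0 * (s + 1) + s)); try (exact: affine_cst || exact: affine_id).
  move=> y; have /(lex_potential (le2 y)) /ltE [k eqk] := h12_lt x y.
  apply/ltE; exists k.
  by rewrite !mul_zero // !add_zero // !(mulC _ 1) !mul1m eqk.
move=> y; have le1 : h1 x y 0 <= h1 (x + 1) 0 0 by apply/h1_le/lex3_x/ltSn.
have [k eqk] := le_add (le_mul le1 (le_refl (s + 1))) (le2 y).
by exists k; rewrite eqk; ring.
Qed.

End Embedding.

(** * Arithmetic comprehension *)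

Definition true_stage (X : M -> Prop) x y z := forall n, n < x ->
  forall s, s < z -> X (cpair n s) -> exists t, t < y /\ X (cpair n t).

Definition coloring (X : M -> Prop) w := exists x y z i,
  w = cpair (triple x y z) i /\
  (i = 1 /\ true_stage X x y z \/ i = 0 /\ ~ true_stage X x y z).

Lemma coloringE X x y z i : coloring X (cpair (triple x y z) i) <->
  i = 1 /\ true_stage X x y z \/ i = 0 /\ ~ true_stage X x y z.
Proof.
split=> [[x' [y' [z' [i' [/cpair_inj [/triple_inj [-> -> ->] ->]]]]]]|] //.
by exists x, y, z, i.
Qed.

Lemma coloring_set X : is_set X ->
  exists C : M -> Prop, is_set C /\ forall w, C w <-> coloring X w.
Proof.
move=> sX.
(* [phi] is [true_stage], with x, y, z, i in variables 3, 2, 1, 0. *)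
pose phi := fallb (tvar 3) (fallb (tvar 2)
  (fimp (fmem (tpair (tvar 1) (tvar 0)) 0)
     (fexb (tvar 4) (fmem (tpair (tvar 2) (tvar 0)) 0)))).
apply: (@Delta_comp (coloring X)
  (fexb (tadd (tvar 1) tone) (fexb (tadd (tvar 2) tone)
    (fexb (tadd (tvar 3) tone) (fexb (tadd (tvar 4) tone)
      (fand (feq (tvar 5) (tpair (ttriple (tvar 3) (tvar 2) (tvar 1)) (tvar 0)))
         (for_ (fand (feq (tvar 0) tone) phi)
               (fand (feq (tvar 0) tzero) (fnot phi))))))))
  (fun=> 0) (fun=> X)) => //=; first by repeat constructor.
move=> _ w; split=> [[x [_ [y [_ [z [_ [i [_ H]]]]]]]]|[x [y [z [i [eqw H]]]]]].
  by exists x, y, z, i.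
have lez : z <= triple x y z by apply: le_cpair2.
have lexy : cpair x y <= triple x y z by apply: le_cpair1.
have lew : triple x y z <= w by rewrite eqw; apply: le_cpair1.
exists x; split; first exact/ltS/(le_trans (le_cpair1 _ _))/(le_trans lexy).
exists y; split; first exact/ltS/(le_trans (le_cpair2 _ _))/(le_trans lexy).
exists z; split; first exact/ltS/(le_trans lez).
exists i; split; first by apply/ltS; rewrite eqw; apply: le_cpair2.
by split.
Qed.

Lemma numeral2 : numeral M 2 = 1 + 1.
Proof. by rewrite /numeral /= addn0m. Qed.

Lemma coloring_fun X : is_fun (power 3) (below 2) (coloring X).
Proof.
split.
- move=> _ [x [y [z [i [-> H]]]]]; exists (triple x y z), i; split=> //.
    by apply/power3P; exists x, y, z.
  rewrite /below numeral2; apply/ltS.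
  by case: H => -[-> _]; [apply: le_refl|apply: le0m].
- move=> w i i' [x [y [z [? [/cpair_inj [-> <-] Ci]]]]] /coloringE Ci'.
  by case: Ci Ci' => -[-> ?] [] [-> ?].
- move=> _ /power3P [x [y [z ->]]]; have [P|nP] := classic (true_stage X x y z).
    exists 1; split; first by rewrite /below numeral2; apply: ltSn.
    by apply/coloringE; left.
  exists 0; split; first by rewrite /below numeral2; apply: lt0S.
  by apply/coloringE; right.
Qed.

Lemma Sigma_comp X : LexIndec 3 2 M -> is_set X ->
  exists Y : M -> Prop, is_set Y /\ forall n, Y n <-> exists s, X (cpair n s).
Proof.
move=> lexind sX.
have [C [sC CE]] := coloring_set sX.
have {CE}CE : C = coloring X.
  by apply: functional_extensionality => w; apply: propositional_extensionality.
have [||h [sh hlex [i hi]]] := lexind C => //; first by rewrite CE; apply: coloring_fun.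
have [h1 [h2 [h3 [hP hmono]]]] := lex_embedding3 hlex.
have {hi}hi x y z : coloring X (cpair (triple (h1 x y z) (h2 x y z) (h3 x y z)) i).
  rewrite -CE; apply: (hi [tuple x; y; z] [tuple h1 x y z; h2 x y z; h3 x y z]).
  exact/hP.
have stage x y z : true_stage X (h1 x y z) (h2 x y z) (h3 x y z).
  (* [h1 1 0 0] dominates [h1 0 y 0] for every [y]; once [h2 0 y0 0] exceeds the bound, the image of
     (0, y0, 0) has colour 1, which fixes the common colour. *)
  have [b bound] := strong_bounding (h1 1 0 0) sX.
  have [y0 lt_b] := h2_unbounded sh hP hmono 0 b.
  have i1 : i = 1.
    have /coloringE [[]|[_ []]] // := hi 0 y0 0.
    move=> n ltn s _ Xns; have [|t [tb Xnt]] := bound n s _ Xns.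
      apply: lt_leT ltn _; apply: (h1_le hmono); apply: lex3_x.
      by rewrite -(addn0m 1); apply: lt0S.
    by exists t; split=> //; apply: lt_ltT lt_b.
  have /coloringE [[]|[i0]] // := hi x y z.
  by case: (@succ_neq0 M ax 0); rewrite addn0m -i1.
(* Past [h2 (n+1) (y+1) 0] the membership of [n] no longer changes: along
   [h (n+1) y _] the third coordinate is unbounded, the second one is below
   this value, and the first one exceeds [n]. *)
pose T n y := h1 (n + 1) y 0 = h1 (n + 1) (y + 1) 0.
have settled n y s : T n y -> X (cpair n s) ->
    exists t, t < h2 (n + 1) (y + 1) 0 /\ X (cpair n t).
  move=> Tny Xns; have [z ltz] := h3_unbounded sh hP hmono s Tny.
  have [|t [tlt Xnt]] := stage (n + 1) y z n _ s ltz Xns.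
    rewrite (h1_const_z hmono _ Tny).
    apply: (lt_leT (ltSn n)); apply: (le_trans (h1_ge sh hP hmono _)).
    have [->|lty] := lex3_y0 (n + 1) y 0; [exact: le_refl|exact: (h1_le hmono)].
  by exists t; split=> //; apply: lt_leT tlt (h2_bound hmono z Tny).
(* Variables 0 to 7 are c', b', c, b, a, y, u, n. Using [a] in both memberships expresses [T n y],
   and [r] speaks about b' = h2 (n + 1) (y + 1) 0. *)
pose psi (r : form) := fexb (tvar 0) (fexb (tvar 1) (fexb (tvar 2) (fexb (tvar 3)
  (fexb (tvar 4) (fexb (tvar 5) (fand
    (fmem (tpair (ttriple (tadd (tvar 7) tone) (tvar 5) tzero)
                 (ttriple (tvar 4) (tvar 3) (tvar 2))) 0)
    (fand
    (fmem (tpair (ttriple (tadd (tvar 7) tone) (tadd (tvar 5) tone) tzero)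
                 (ttriple (tvar 4) (tvar 1) (tvar 0))) 0) r))))))).
pose early := fexb (tvar 1) (fmem (tpair (tvar 8) (tvar 0)) 1).
pose E := scons h (fun=> X).
have sE j : is_set (E j) by case: j.
have psiE n (r : form) (Q : M -> Prop) :
    (forall c' b' c b a y u,
       sat (prepend [:: c'; b'; c; b; a; y; u; n] (fun=> 0)) E r <-> Q b') ->
    (exists u, sat (prepend [:: u; n] (fun=> 0)) E (psi r)) <->
    exists y, T n y /\ Q (h2 (n + 1) (y + 1) 0).
  move=> rQ; split.
    move=> [u [y [_ [a [_ [b [_ [c [_ [b' [_ [c' [_ [hy [hy' /rQ Qb]]]]]]]]]]]]]]].
    exists y; move: hy hy' Qb => /= /hP [eqa _ _] /hP [eqa' -> _] Qb.
    by split=> //; rewrite /T -eqa.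
  move=> [y [Tny Qb]].
  set a := h1 (n + 1) y 0; set b := h2 (n + 1) y 0; set c := h3 (n + 1) y 0.
  set b' := h2 (n + 1) (y + 1) 0; set c' := h3 (n + 1) (y + 1) 0.
  exists (y + a + b + c + b' + c' + 1).
  exists y; split; first by apply/ltS; exists (a + b + c + b' + c'); rewrite /=; ring.
  exists a; split; first by apply/ltS; exists (y + b + c + b' + c'); rewrite /=; ring.
  exists b; split; first by apply/ltS; exists (y + a + c + b' + c'); rewrite /=; ring.
  exists c; split; first by apply/ltS; exists (y + a + b + b' + c'); rewrite /=; ring.
  exists b'; split; first by apply/ltS; exists (y + a + b + c + c'); rewrite /=; ring.
  exists c'; split; first by apply/ltS; exists (y + a + b + c + b'); rewrite /=; ring.
  split; first exact/hP.
  split; first by apply/hP; split=> //; apply: Tny.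
  exact/rQ.
have PhiE n : (exists u, sat (prepend [:: u; n] (fun=> 0)) E (psi early)) <->
    exists s, X (cpair n s).
  rewrite (psiE n early (fun b => exists s, s < b /\ X (cpair n s))) //.
  split=> [[y [_ [s [_ Xns]]]]|[s Xns]]; first by exists s.
  have [y Tny] := h1_stable sh hP hmono (n + 1).
  by exists y; split=> //; apply: settled Xns.
(* The Pi_1 form: no stable [y] has [n] still missing before the settling stage. [h1_stable]
   supplies a stable [y], so this is not vacuous. *)
have PiE n : (forall u, sat (prepend [:: u; n] (fun=> 0)) E (fnot (psi (fnot early)))) <->
    exists s, X (cpair n s).
  have := psiE n (fnot early) (fun b => ~ exists s, s < b /\ X (cpair n s)).
  case=> // psi1 psi2; split=> [H|[s Xns] u psiu]; last first.
    have [|y [Tny []]] := psi1; first by exists u.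
    exact: settled Xns.
  apply: NNPP => noX; have [y Tny] := h1_stable sh hP hmono (n + 1).
  have [|u] := psi2; last exact: H.
  by exists y; split=> // -[s [_ Xns]]; apply: noX; exists s.
have bSigma : bounded (psi early) by repeat constructor.
have bPi : bounded (fnot (psi (fnot early))) by repeat constructor.
have [n|Y [sY YE]] := RCA0_comprehension RM
    (Sigma01_ex bSigma) (Pi01_all bPi) sE (e := fun=> 0).
  by apply: iff_trans (iff_sym (PiE n)); apply: PhiE.
by exists Y; split=> // n; rewrite YE; apply: PhiE.
Qed.


(** * Codes of tuples and induction on arithmetical formulas *)

Fixpoint tren (f : nat -> nat) (t : term) : term :=
  match t with
  | tvar n => tvar (f n)
  | tzero => tzero
  | tone => tone
  | tadd t1 t2 => tadd (tren f t1) (tren f t2)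
  | tmul t1 t2 => tmul (tren f t1) (tren f t2)
  end.

Lemma eval_tren e e' (f : nat -> nat) (t : term) :
  (forall n : nat, e (f n) = e' n) -> eval e (tren f t) = eval e' t.
Proof. by move=> ff'; elim: t => //= [t1 -> t2 ->|t1 -> t2 ->]. Qed.

Lemma eval_tshift e x (t : term) : eval (scons x e) (tshift t) = eval e t.
Proof. by elim: t => //= [t1 -> t2 ->|t1 -> t2 ->]. Qed.

(** The head is the outermost second component, so quantifying variable 0 is a projection of the
    form handled by [Sigma_comp]. *)
Fixpoint code (s : seq M) : M :=
  if s is x :: s' then cpair (code s') x else 0.

Fixpoint tcodes (k : nat) : term :=
  if k is k'.+1 then tpair (tshift (tcodes k')) (tvar 0) else tzero.

Lemma eval_tcodes e (s : seq M) : eval (prepend s e) (tcodes (size s)) = code s.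
Proof. by elim: s => //= x s IH; rewrite eval_tshift IH. Qed.

(** Lengths are compared separately because [cpair 0 0] is 0, the code of the empty tuple. *)
Lemma code_inj (s s' : seq M) : size s = size s' -> code s = code s' -> s = s'.
Proof.
elim: s s' => [|x s IH] [|x' s'] //= [eqs] /cpair_inj [eqc ->].
by rewrite (IH s').
Qed.

Lemma le_code (s : seq M) (P : M -> Prop) : (forall x, x <= code s -> P x) ->
  foldr (fun x Q => P x /\ Q) True s.
Proof.
elim: s => //= x s IH Pc; split; first exact/Pc/le_cpair2.
by apply: IH => y ley; apply/Pc/(le_trans ley)/le_cpair1.
Qed.

(** The innermost of the [k] quantifiers lies under [k - 1] others and the dummy, so its [tvar k] is
    the code [w], which bounds all entries. *)
Fixpoint bexs (k : nat) (p : form) : form :=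
  if k is k'.+1 then bexs k' (fexb (tadd (tvar k) tone) p) else p.

Lemma bounded_bexs (k : nat) (p : form) : bounded p -> bounded (bexs k p).
Proof. by elim: k p => //= k IH p bp; apply: IH; constructor. Qed.

Lemma prepend_size (s : seq M) e (n : nat) : prepend s e (size s + n)%N = e n.
Proof. by elim: s. Qed.

Lemma sat_bexs (k : nat) (p : form) m w e (E : nat -> M -> Prop) :
  sat (scons m (scons w e)) E (bexs k p) <->
  exists s : seq M, [/\ size s = k, foldr (fun x Q => x < w + 1 /\ Q) True s
    & sat (prepend s (scons m (scons w e))) E p].
Proof.
elim: k p => [|k IH] p /=.
  by split=> [satp|[[|x s] []//]]; exists [::].
rewrite IH; split=> [[s [sz_s bs [x [/= ltx satp]]]]|].
  exists (x :: s); split=> //=; first by rewrite sz_s.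
  by split=> //; move: ltx; rewrite -addn1 -sz_s prepend_size.
move=> [[|x s] []//= [sz_s] [ltx bs] satp].
exists s; split=> //=; exists x; split=> //=.
by rewrite -addn1 -sz_s prepend_size.
Qed.

(** All [k] are treated at once so that a quantifier can call on [k + 1]; variables beyond the tuple
    remain parameters. *)
Definition definable e (E : nat -> M -> Prop) (p : form) := forall k : nat,
  exists X : M -> Prop, is_set X /\
    forall s : seq M, size s = k -> X (code s) <-> sat (prepend s e) E p.

(* Two extra variables sit between the tuple and the parameters: a dummy and
   the code of the tuple. *)
Definition gap (k n : nat) : nat := if (n < k)%N then n else n.+2.

Lemma prepend_gap (s : seq M) e m w (n : nat) :
  prepend s (scons m (scons w e)) (gap (size s) n) = prepend s e n.
Proof.
rewrite /gap; elim: s n => [|x s IH] [|n] //=.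
by rewrite ltnS -IH; case: ifP.
Qed.

(** The set consists of those [w] that code some tuple satisfying [p]; by [le_code] this search is
    bounded by [w]. *)
Lemma definable_bounded e (E : nat -> M -> Prop) (p : form) :
    (forall i, is_set (E i)) ->
    (forall k : nat, exists2 p', bounded p' & forall (s : seq M) m w, size s = k ->
      sat (prepend s (scons m (scons w e))) E p' <-> sat (prepend s e) E p) ->
  definable e E p.
Proof.
move=> sE liftp k; have [p' bp' p'E] := liftp k.
have [|m w|X [sX XE]] := @Delta_comp (fun w => exists s : seq M,
    [/\ size s = k, w = code s & sat (prepend s e) E p])
  (bexs k (fand (feq (tvar k.+1) (tcodes k)) p')) e E _ sE.
- by apply: bounded_bexs; apply: bounded_and => //; constructor.
- rewrite sat_bexs; split=> -[s [sz_s]].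
    move=> _ /= [eqw /p'E satp]; exists s; split=> //; last exact: satp.
    by move: eqw; rewrite -{1 2}sz_s -addn1 prepend_size eval_tcodes.
  move=> eqw satp; exists s; split=> //.
    by apply: le_code => x lex; apply/ltS; rewrite eqw.
  split; last exact/p'E.
  by rewrite /= -sz_s -addn1 prepend_size eval_tcodes.
exists X; split=> // s sz_s; rewrite XE; split=> [[s' [sz_s' eqc satp]]|satp].
  by rewrite (@code_inj s s') // sz_s.
by exists s.
Qed.

Lemma definable_form e (E : nat -> M -> Prop) (p : form) : LexIndec 3 2 M ->
  (forall i, is_set (E i)) -> arithmetical p -> definable e E p.
Proof.
move=> lexind sE.
have tgap (t : term) (s : seq M) m w :
    eval (prepend s (scons m (scons w e))) (tren (gap (size s)) t) =
    eval (prepend s e) t.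
  exact/eval_tren/prepend_gap.
have compl (X : M -> Prop) : is_set X ->
    exists Y : M -> Prop, is_set Y /\ forall n, Y n <-> ~ X n.
  move=> sX; apply: (@Delta_comp _ (fnot (fmem (tvar 1) 0)) (fun=> 0)
    (fun=> X)) => //.
  by repeat constructor.
have binop (op : form -> form -> form) (Op : Prop -> Prop -> Prop)
      (q r : form) :
    (forall q r : form, bounded q -> bounded r -> bounded (op q r)) ->
    (forall e' (E' : nat -> M -> Prop) (q r : form),
      sat e' E' (op q r) <-> Op (sat e' E' q) (sat e' E' r)) ->
    definable e E q -> definable e E r -> definable e E (op q r).
  move=> bop satop defq defr k.
  have [X [sX XE]] := defq k; have [Y [sY YE]] := defr k.
  have [| |m n|Z [sZ ZE]] := @Delta_comp (fun n => Op (X n) (Y n))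
    (op (fmem (tvar 1) 0) (fmem (tvar 1) 1)) (fun=> 0)
    (scons X (fun=> Y)).
  - by apply: bop; constructor.
  - by case.
  - by rewrite satop.
  exists Z; split=> // s sz_s; rewrite ZE satop.
  (* [Op] is an arbitrary operation on propositions, so equivalents are substituted as equals. *)
  by rewrite (propositional_extensionality _ _ (XE s sz_s))
             (propositional_extensionality _ _ (YE s sz_s)).
elim: p => /= [t1 t2 _|t1 t2 _|t X _|q IHq /IHq defq
  |q IHq r IHr /andP [/IHq defq /IHr defr]
  |q IHq r IHr /andP [/IHq defq /IHr defr]
  |q IHq r IHr /andP [/IHq defq /IHr defr]
  |q IHq r IHr /andP [/IHq defq /IHr defr]
  |q IHq /IHq defq|q IHq /IHq defq|//|//].
- apply: definable_bounded => // k.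
  exists (feq (tren (gap k) t1) (tren (gap k) t2)); first by constructor.
  by move=> s m w <- /=; rewrite !tgap.
- apply: definable_bounded => // k.
  exists (flt (tren (gap k) t1) (tren (gap k) t2)); first by constructor.
  by move=> s m w <- /=; rewrite !tgap.
- apply: definable_bounded => // k.
  exists (fmem (tren (gap k) t) X); first by constructor.
  by move=> s m w <- /=; rewrite !tgap.
- move=> k; have [X [/compl [Y [sY YE]] XE]] := defq k.
  by exists Y; split=> // s sz_s; rewrite YE XE.
- by apply: (binop fand and) => // *; constructor.
- by apply: (binop for_ or) => // *; constructor.
- by apply: (binop fimp (fun P Q => P -> Q)) => // *; constructor.
- by apply: (binop fiff iff) => // *; constructor.
(* A universal quantifier is treated as the complement of a projected complement. *)
- move=> k; have [X [/compl [Y [sY YE]] XE]] := defq k.+1.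
  have [Z [/compl [W [sW WE]] ZE]] := Sigma_comp lexind sY.
  exists W; split=> // s sz_s; rewrite WE ZE.
  have {}XE x : X (cpair (code s) x) <-> sat (scons x (prepend s e)) E q.
    by apply: (XE (x :: s)); rewrite /= sz_s.
  split=> [nY x|satq [x /YE []]]; last exact/XE.
  by apply/XE; apply: NNPP => nX; apply: nY; exists x; apply/YE.
- move=> k; have [X [sX XE]] := defq k.+1.
  have [Z [sZ ZE]] := Sigma_comp lexind sX.
  exists Z; split=> // s sz_s; rewrite ZE.
  by split=> -[x /(XE (x :: s)) H]; exists x; apply: H; rewrite /= sz_s.
Qed.

End Model.

Theorem theorem2p10 (M : L2structure) :
  RCA0 M -> LexIndec 3 2 M -> arithmetic_comprehension M.
Proof.
move=> RM lexind p e E ap sE.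
have [X [sX XE]] := definable_form RM e lexind sE ap 1.
(* The one-entry code of [n] is [cpair 0 n]; a last comprehension pulls [X] back along it. *)
have [|m n|Y [sY YE]] := @Delta_comp M RM (fun n => X (code [:: n]))
  (fmem (tpair tzero (tvar 1)) 0) e (fun=> X) _ (fun=> sX).
- by constructor.
- by [].
by exists Y; split=> // n; rewrite YE XE.
Qed.
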